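(* Let $G$ be a countably infinite amenable group with a Følner sequence $F=(F_N)_{N\in\mathbb{N}}$. Then there is a set $E\subseteq G$ such that, for all finite nonempty $A\subseteq G$, the densities below exist and $$d_F(E)=d_F\left(\bigcup_{g\in A}gE\right)=\frac{1}{2}.$$
   Context: A (left) Følner sequence in a countable group $G$ is a sequence $F=(F_N)_{N\in\mathbb{N}}$ of (nonempty) finite subsets of $G$ such that $\lim_{N\to\infty}\frac{|gF_N\Delta F_N|}{|F_N|}=0$ for all $g\in G$; $G$ is (left) amenable if it has a Følner sequence. For $E\subseteq G$, $d_F(E):=\lim_{N\to\infty}\frac{|E\cap F_N|}{|F_N|}$ when this limit exists. *)

(* Defs.v *)
From mathcomp Require Import all_boot all_order all_algebra finmap.
From mathcomp Require Import all_classical all_reals all_analysis.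

Set Implicit Arguments.
Unset Strict Implicit.
Unset Printing Implicit Defensive.

Import Order.TTheory GRing.Theory Num.Theory.
Import numFieldNormedType.Exports.

Local Open Scope classical_set_scope.
Local Open Scope ring_scope.

Definition lcoset_set (G : groupType) (g : G) (E : set G) : set G :=
  [set (g * x)%g | x in E].

Definition lcoset_fset (G : groupType) (g : G) (A : {fset G}) : {fset G} :=
  [fset (g * x)%g | x in A]%fset.

Definition symdiff (G : groupType) (A B : {fset G}) : {fset G} :=
  ((A `\` B) `|` (B `\` A))%fset.

(* Amenability of G is the existence of such a sequence. *)
Definition folner (R : realType) (G : groupType) (F : nat -> {fset G}) : Prop :=
  (forall N, F N != fset0) /\
  (forall g : G,
     (fun N => #|` symdiff (lcoset_fset g (F N)) (F N)|%:R / #|` F N|%:R : R)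
       @ \oo --> (0 : R)).

(* d_F(E) exists and is equal to d. *)
Definition has_density (R : realType) (G : groupType) (F : nat -> {fset G})
    (E : set G) (d : R) : Prop :=
  (fun N => #|` [fset x in F N | x \in E]%fset|%:R / #|` F N|%:R : R)
    @ \oo --> d.

(* Main.v *)
Require Import Defs.
From mathcomp Require Import all_boot all_order all_algebra finmap.
From mathcomp Require Import zify ring lra.
From mathcomp Require Import all_classical all_reals all_analysis.
Import Order.TTheory GRing.Theory Num.Theory.
Import numFieldNormedType.Exports.

Local Open Scope classical_set_scope.
Local Open Scope ring_scope.

Set Implicit Arguments.
Unset Strict Implicit.
Unset Printing Implicit Defensive.

(** It suffices to find E of density 1/2 with d_F(E \Delta gE) = 0 for every g.
    Choose increasingly invariant shapes T_j, each the disjoint union of two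
    translates S1_j, S2_j of one Folner set. For every M, an Ornstein-Weiss
    quasi-tiling proceeds from j = M down to j = 0, greedily adding translates
    of T_j that overlap the earlier tiles in at most an eps_j-fraction,
    eps_j = 1/(j+2), and that avoid the finitely many F_N that are not yet
    invariant under T_j. Stage j multiplies the uncovered proportion of each
    later F_N by about 1 - eps_j, and prod (1 - eps_j) telescopes to 0; hence,
    for large N and uniformly in M >= N, almost all of F_N is covered by tiles
    of large index. The set E_M made of the S1-halves of the tiles is then
    almost balanced and almost invariant on F_N for all large N <= M, and these
    conditions pass to a limit of the E_M along an ultrafilter, since each of
    them involves finitely many points of G. *)

(** * Translates, boundaries and double counting in a group *)

Section Boundary.
Local Open Scope fset_scope.
Variable G : groupType.
Implicit Types (A B D F S W : {fset G}) (c x : G).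

Definition rtrans A c : {fset G} := [fset (t * c)%g | t in A].

Definition bdry D S : {fset G} := [fset x in S | has (fun h => (h * x)%g \notin S) D].

Lemma in_rtrans A c x : (x \in rtrans A c) = ((x * c^-1)%g \in A).
Proof.
apply/imfsetP/idP => [[t /= At ->]|Ax]; first by rewrite mulgK.
by exists (x * c^-1)%g; rewrite ?mulgVK.
Qed.

Lemma card_rtrans A c : #|` rtrans A c| = #|` A|.
Proof. by rewrite /rtrans card_imfset //; exact: mulIg. Qed.

Lemma rtransU A B c : rtrans (A `|` B) c = rtrans A c `|` rtrans B c.
Proof. by apply/fsetP=> x; rewrite !(in_rtrans, inE). Qed.

Lemma bdryP D S x :
  reflect (x \in S /\ exists2 h, h \in D & (h * x)%g \notin S) (x \in bdry D S).
Proof. by rewrite !inE /=; apply: (iffP andP) => -[? /hasP]. Qed.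

(** Left and right multiplications commute, so every right translate of a shape is as invariant as
    the shape itself. *)
Lemma bdry_rtrans D S c : bdry D (rtrans S c) = rtrans (bdry D S) c.
Proof.
apply/fsetP=> x; rewrite in_rtrans; apply/bdryP/bdryP; rewrite in_rtrans;
  by move=> [? [h Dh hx]]; split => //; exists h => //; move: hx; rewrite in_rtrans mulgA.
Qed.

Lemma bdryU D A B : bdry D (A `|` B) `<=` bdry D A `|` bdry D B.
Proof.
apply/fsubsetP=> x /bdryP[+ [h Dh]]; rewrite !in_fsetU negb_or.
move=> /orP[Ax|Bx] /andP[hA hB].
  by apply/orP; left; apply/bdryP; split => //; exists h.
by apply/orP; right; apply/bdryP; split => //; exists h.
Qed.

Lemma bdryS D D' S : D `<=` D' -> bdry D S `<=` bdry D' S.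
Proof.
move=> /fsubsetP DD'; apply/fsubsetP=> x /bdryP[Sx [h Dh hx]].
by apply/bdryP; split => //; exists h => //; exact: DD'.
Qed.

Lemma card_bdryU D A B :
  (#|` bdry D (A `|` B)| <= #|` bdry D A| + #|` bdry D B|)%N.
Proof.
apply: leq_trans (fsubset_leq_card (bdryU _ _ _)) _.
by rewrite cardfsU leq_subr.
Qed.

Lemma card_fset_sum (A : {fset G}) (P : pred G) :
  #|` [fset x in A | P x]| = (\sum_(x <- A) P x)%N.
Proof.
rewrite card_fset_sum1 big_fset /=.
by rewrite big_mkcond /=; apply: eq_bigr => x _; case: (P x).
Qed.

(** Both sides count the pairs of [t] in [A] and [x] in [F] with [t * x] in [W]. *)
Lemma sum_card_rtrans A W F : 
  (\sum_(x <- F) #|` rtrans A x `&` W| =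
   \sum_(t <- A) #|` [fset x in F | (t * x)%g \in W]|)%N.
Proof.
transitivity (\sum_(x <- F) \sum_(t <- A) ((t * x)%g \in W))%N.
  apply: eq_bigr => x _.
  rewrite -(card_fset_sum A (fun t => (t * x)%g \in W)).
  rewrite -[RHS](card_rtrans _ x); congr (#|` _|).
  by apply/fsetP=> z; rewrite !(in_rtrans, inE) /= mulgVK.
rewrite exchange_big /=; apply: eq_bigr => t _.
by rewrite -(card_fset_sum F (fun x => (t * x)%g \in W)).
Qed.

(** Off the boundary, multiplication by [t] is an injection into the intersection of [F] and [W]. *)
Lemma card_lpreim F W (D : {fset G}) t : t \in D ->
  (#|` [fset x in F | (t * x)%g \in W]| <= #|` F `&` W| + #|` bdry D F|)%N.
Proof.
move=> Dt; set X := [fset x in F | _].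
rewrite -(cardfsID (bdry D F) X) addnC leq_add //; last first.
  exact/fsubset_leq_card/fsubsetIr.
have <- : #|` [fset (t * x)%g | x in X `\` bdry D F]| = #|` X `\` bdry D F|.
  by rewrite card_imfset //; exact: mulgI.
apply/fsubset_leq_card/fsubsetP => z /imfsetP[x /=].
rewrite !inE /= => /andP[nb /andP[Fx tW]] ->; rewrite tW andbT.
by apply: contraNT nb => tF; rewrite Fx /=; apply/hasP; exists t.
Qed.

End Boundary.

(** * Greedy quasi-tilings, stored as lists of tiles *)

Section Tiling.
Local Open Scope fset_scope.
Variables (G : groupType) (S1 S2 K : nat -> {fset G}).
Implicit Types (L : seq (nat * G)) (t : nat * G) (c x : G) (cs : seq G).

Definition shape j : {fset G} := S1 j `|` S2 j.

Definition tile t : {fset G} := rtrans (shape t.1) t.2.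

Fixpoint cover L : {fset G} :=
  if L is t :: L' then cover L' `|` tile t else fset0.

(** For the successive tiles of a list these sets partition the cover, so counting can proceed tile
    by tile. *)
Definition part t L : {fset G} := tile t `\` cover L.

(** A point covered several times is coloured by the tile placed first, so later tiles never alter a
    colour. *)
Fixpoint half L : {fset G} :=
  if L is t :: L' then half L' `|` (rtrans (S1 t.1) t.2 `\` cover L') else fset0.

(* The head of a list of tiles is the tile placed last. The inequality says that
   the overlap is at most [|T_j| / (j + 2)]. *)
Definition fits t L : bool :=
  [disjoint tile t & K t.1]%fset && (#|` tile t `&` cover L| * t.1.+2 <= #|` shape t.1|)%N.

Fixpoint valid L : bool :=
  if L is t :: L' then fits t L' && valid L' else true.

Definition stage cs j L : seq (nat * G) :=
  foldr (fun c L' => if fits (j, c) L' then (j, c) :: L' else L') L cs.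

(** [foldr] treats the head of [iota] last, so the indices run downwards from [j + n - 1] to [j]. *)
Definition tiling cs j n : seq (nat * G) := foldr (stage cs) [::] (iota j n).

Lemma cover_cat L1 L2 : cover L2 `<=` cover (L1 ++ L2).
Proof. by elim: L1 => //= t L1 IH; apply: fsubset_trans IH _; exact: fsubsetUl. Qed.

Lemma stage_cat cs j L :
  exists2 L', stage cs j L = L' ++ L & all (fun t => t.1 == j) L'.
Proof.
elim: cs => [|c cs [L' /= -> allL']]; first by exists [::].
by case: ifP => _; [exists ((j, c) :: L') => //=; rewrite eqxx | exists L'].
Qed.

Lemma valid_stage cs j L : valid L -> valid (stage cs j L).
Proof. by move=> vL; elim: cs => //= c cs IH; case: ifP => //= ->. Qed.

Lemma valid_tiling cs j n : valid (tiling cs j n).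
Proof. by elim: n j => //= n IH j; exact/valid_stage/IH. Qed.

Lemma tilingS cs j n : tiling cs j n.+1 = stage cs j (tiling cs j.+1 n).
Proof. by []. Qed.

Lemma tiling_ge cs j n : all (fun t => j <= t.1)%N (tiling cs j n).
Proof.
elim: n j => // n IH j; rewrite tilingS.
have [L' -> allL'] := stage_cat cs j (tiling cs j.+1 n).
rewrite all_cat; apply/andP; split.
  by apply: sub_all allL' => t /= /eqP ->.
by apply: sub_all (IH j.+1) => t /=; exact: ltnW.
Qed.

(** Stages only prepend tiles, so the tiling by the large indices survives as a suffix and can be
    studied alone. *)
Lemma tiling_cat cs j m n :
  exists L, tiling cs j (m + n) = L ++ tiling cs (j + m) n.
Proof.
elim: m j => [|m IH] j; first by exists [::]; rewrite addn0.
rewrite addSn tilingS addnS -addSn; have [L ->] := IH j.+1.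
have [L' -> _] := stage_cat cs j (L ++ tiling cs (j.+1 + m) n).
by exists (L' ++ L); rewrite catA.
Qed.

(** An accepted tile is covered entirely; a rejected one overlapped the cover too much when it was
    tried, and the cover only grows afterwards. *)
Lemma stage_cover cs j L c : c \in cs -> [disjoint tile (j, c) & K j]%fset ->
  (#|` shape j| <= #|` tile (j, c) `&` cover (stage cs j L)| * j.+2)%N.
Proof.
move=> + dis; elim: cs => //= d cs IH; rewrite inE => /orP[/eqP <-|ccs].
  case: ifPn => [_|]; last by rewrite /fits dis /= -ltnNge; exact: ltnW.
  rewrite /= (fsetIidPl _) ?fsubsetUr // /tile card_rtrans /=.
  by rewrite leq_pmulr.
apply: leq_trans (IH ccs) _; case: ifP => //= _.
by rewrite leq_mul2r fsubset_leq_card ?orbT // fsetIS // fsubsetUl.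
Qed.

Lemma part_half L1 t L x : x \in part t L ->
  (x \in half (L1 ++ t :: L)) = (x \in rtrans (S1 t.1) t.2).
Proof.
have half_cover L' y : y \in half L' -> y \in cover L'.
  elim: L' => //= u L' IH; rewrite !inE => /orP[/IH -> //|/andP[_ yS]].
  by rewrite /tile rtransU inE yS /= orbT.
rewrite /part inE => /andP[xL xt]; elim: L1 => [|u L1 IH] /=.
  rewrite !inE xL /=; case: (boolP (x \in half L)) => // /half_cover.
  by rewrite (negPf xL).
rewrite -IH !inE.
suff -> : x \in cover (L1 ++ t :: L) by rewrite /= orbF.
by apply: (fsubsetP (cover_cat _ _)); rewrite /= inE xt orbT.
Qed.

Lemma valid_cat L1 L2 : valid (L1 ++ L2) -> valid L2.
Proof. by elim: L1 => //= t L1 IH /andP[_]. Qed.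

(* A bound on a set [B] tile by tile, except inside [Q], adds up to a global
   bound because the parts are disjoint. *)
Lemma card_cover_le (R : realFieldType) (F B Q : {fset G}) (k : R) L :
    (0 <= k)%R ->
    (forall L1 t L2, L = L1 ++ t :: L2 ->
       B `&` part t L2 `<=` Q \/
       part t L2 `<=` F /\ (#|` B `&` part t L2|%:R <= k * #|` part t L2|%:R)%R) ->
  (#|` B `&` cover L|%:R <= k * #|` F|%:R + #|` Q|%:R)%R.
Proof.
move=> k0 HL.
(* Cutting [F] and [Q] down to the cover makes both sides additive over the parts, as the induction
   requires. *)
suff : (#|` B `&` cover L|%:R <= k * #|` F `&` cover L|%:R + #|` Q `&` cover L|%:R)%R.
  move=> /le_trans; apply; apply: lerD; last by rewrite ler_nat fsubset_leq_card // fsubsetIl.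
  by rewrite ler_wpM2l // ler_nat fsubset_leq_card // fsubsetIl.
elim: L HL => [|t L IH] HL.
  by rewrite /= !fsetI0 cardfs0 mulr0 addr0.
have split (X : {fset G}) : #|` X `&` cover (t :: L)| = (#|` X `&` cover L| + #|` X `&` part t L|)%N.
  have -> : X `&` cover (t :: L) = (X `&` cover L) `|` (X `&` part t L).
    by apply/fsetP=> z; rewrite !inE; case: (z \in X); case: (z \in cover L); case: (z \in tile t).
  rewrite cardfsU (_ : (_ `&` _) `&` (_ `&` _) = fset0) ?cardfs0 ?subn0 //.
  by apply/fsetP=> z; rewrite !inE; case: (z \in cover L); rewrite ?andbF.
have {}IH := IH (fun L1 u L2 e => HL (t :: L1) u L2 (f_equal (cons t) e)).
rewrite !split !natrD mulrDr addrACA; apply: lerD => //.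
have [BQ|[PF BP]] := HL [::] t L erefl.
  apply: (@le_trans _ _ (#|` Q `&` part t L|%:R)%R); last by rewrite lerDr mulr_ge0.
  by rewrite ler_nat fsubset_leq_card // fsubsetI BQ fsubsetIr.
by apply: le_trans BP _; rewrite (fsetIidPr PF) lerDl.
Qed.

End Tiling.

(** * Counting estimates for a tiling on one finite set *)

Section Estimates.
Local Open Scope fset_scope.
Local Open Scope ring_scope.
Variables (R : realFieldType) (G : groupType) (S1 S2 K X : nat -> {fset G}).
Implicit Types (F B Q : {fset G}) (L : seq (nat * G)) (t : nat * G) (cs : seq G).

Local Notation "#r A" := (#|` A|%:R : R) (at level 10, A at level 8).
Local Notation T := (shape S1 S2).
Local Notation tile := (tile S1 S2).
Local Notation cover := (cover S1 S2).
Local Notation part := (part S1 S2).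
Local Notation half := (half S1 S2).
Local Notation valid := (valid S1 S2 K).
Local Notation stage := (stage S1 S2 K).
Local Notation tiling := (tiling S1 S2 K).

Definition eps j : R := j.+2%:R^-1.
(** A difference of consecutive reciprocals ([delE]): over all [j >= a] these errors sum to at most
    [1 / (a + 1)]. *)
Definition del j : R := j.+1%:R^-1 * j.+2%:R^-1.

Lemma eps_gt0 j : 0 < eps j. Proof. by rewrite invr_gt0. Qed.
Lemma del_gt0 j : 0 < del j. Proof. by rewrite mulr_gt0 ?invr_gt0. Qed.

Lemma eps_le i j : (i <= j)%N -> eps j <= eps i.
Proof. by move=> ij; rewrite lef_pV2 ?posrE ?ler_nat. Qed.

Lemma del_le i j : (i <= j)%N -> del j <= del i.
Proof.
by move=> ij; rewrite ler_pM ?invr_ge0 ?lef_pV2 ?posrE ?ler_nat //; exact: ler0n.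
Qed.

Lemma eps_half j : eps j <= 2^-1.
Proof. by rewrite lef_pV2 ?posrE ?ler_nat. Qed.

Lemma epsE j : 1 - eps j = j.+1%:R * eps j.
Proof.
have j2 : (j.+2%:R : R) != 0 by rewrite pnatr_eq0.
by apply: (mulIf j2); rewrite mulrBl /eps !mulfVK // mulVf // mul1r -natr1 addrK.
Qed.

Lemma delE j : del j = j.+1%:R^-1 - j.+2%:R^-1.
Proof.
suff gen (a : R) : a != 0 -> a + 1 != 0 -> a^-1 * (a + 1)^-1 = a^-1 - (a + 1)^-1.
  by rewrite /del -[j.+2%:R]natr1 gen // ?natr1 pnatr_eq0.
by move=> a0 b0; field; rewrite b0 a0.
Qed.

Hypothesis cardS : forall j, #|` S1 j| = #|` S2 j|.
Hypothesis disjS : forall j, [disjoint S1 j & S2 j]%fset.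
Hypothesis S1_neq0 : forall j, S1 j != fset0.
Hypothesis invS1 : forall j, #r (bdry (X j) (S1 j)) <= del j * #r (S1 j).
Hypothesis invS2 : forall j, #r (bdry (X j) (S2 j)) <= del j * #r (S2 j).
Hypothesis shape_sub : forall i j, (i < j)%N -> T i `<=` X j.

Lemma card_shape j : #|` T j| = (#|` S1 j| + #|` S2 j|)%N.
Proof. by rewrite /shape cardfsU (disjoint_fsetI0 (disjS j)) cardfs0 subn0. Qed.

Lemma bdry_shape i j : (i < j)%N -> #r (bdry (T i) (T j)) <= del i * #r (T j).
Proof.
move=> ij; apply: (@le_trans _ _ (del j * #r (T j))); last first.
  by rewrite ler_wpM2r ?ler0n ?del_le // ltnW.
rewrite card_shape natrD mulrDr.
apply: le_trans (lerD (invS1 j) (invS2 j)); rewrite -natrD ler_nat.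
apply: leq_trans (card_bdryU _ _ _).
exact/fsubset_leq_card/bdryS/shape_sub.
Qed.

Lemma card_part t L : fits S1 S2 K t L -> (1 - eps t.1) * #r (T t.1) <= #r (part t L).
Proof.
move=> /andP[_ fit]; rewrite /part; have := cardfsID (cover L) (tile t).
move=> /(congr1 (fun n => n%:R : R)); rewrite natrD {2}/tile card_rtrans => e.
suff : #r (tile t `&` cover L) <= eps t.1 * #r (T t.1) by lra.
by rewrite mulrC ler_pdivlMr // -natrM ler_nat.
Qed.

(** As [eps] is at most 1/2, bounds relative to a shape become bounds relative to a part at the cost
    of a factor 2. *)
Lemma card_shape_part t L : fits S1 S2 K t L -> #r (T t.1) <= 2 * #r (part t L).
Proof.
move=> /card_part; have := eps_half t.1; have : 0 <= #r (T t.1) by exact: ler0n.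
nra.
Qed.

Section OneSet.
Variables (F Q : {fset G}) (cs : seq G).
Hypothesis Fcs : {subset F <= cs}.
(* [Q] collects the points of [F] lying in admissible tiles that stick out of [F]. *)
Hypothesis crossing : forall t, [disjoint tile t & K t.1]%fset ->
  F `&` tile t `<=` Q \/ tile t `<=` F.

Lemma card_le_parts B (k : R) L : B `<=` F -> 0 <= k -> valid L ->
    (forall L1 t L2, L = L1 ++ t :: L2 -> fits S1 S2 K t L2 ->
       #r (B `&` part t L2) <= k * #r (part t L2)) ->
  #r (B `&` cover L) <= k * #r F + #r Q.
Proof.
move=> BF k0 vL Hk; apply: card_cover_le => // L1 t L2 LE.
have ft : fits S1 S2 K t L2 by move: vL; rewrite LE => /valid_cat /= /andP[].
have [FQ|tF] := crossing (proj1 (andP ft)); [left|right].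
  by apply: fsubset_trans (fsetISS BF (fsubsetDl _ _)) FQ.
by split; [exact: fsubset_trans (fsubsetDl _ _) tF | exact: Hk LE ft].
Qed.

(* Double counting of the pairs [(t, x)] with [t * x] covered after the stage: a
   translate [T_j x] inside [W] counts fully, and by maximality any other one,
   away from [K j], counts at least [|T_j| / (j + 2)]. *)
Lemma stage_uncovered j L : bdry (T j) F `<=` Q ->
    #r Q <= del j * #r F -> #r (T j) * #r (K j) <= del j * #r F ->
    valid L -> all (fun t => j < t.1)%N L ->
  #r (F `\` cover (stage cs j L)) <=
    (1 - eps j) * #r (F `\` cover L) + 5 * (del j * #r F).
Proof.
move=> bQ Qle Kle vL jL.
set W := cover L; set W' := cover _.
(* [I] holds the points counted with full weight, [E] those about which maximality says nothing, and
   [B] the points of the old cover that [I] misses. *)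
pose I := [fset x in F | tile (j, x) `<=` W].
pose E := [fset x in F | ~~ [disjoint tile (j, x) & K j]%fset].
pose B := [fset x in F | (x \in W) && ~~ (tile (j, x) `<=` W)].
have n_gt0 : (0 < #|` T j|)%N.
  by rewrite card_shape addn_gt0 cardfs_gt0 S1_neq0.
have WW' : W `<=` W'.
  by rewrite /W' /W; have [L' -> _] := stage_cat S1 S2 K cs j L; exact: cover_cat.
have sumW' : (\sum_(x <- F) #|` tile (j, x) `&` W'| <=
    #|` T j| * (#|` F `&` W'| + #|` Q|))%N.
  rewrite /tile /= sum_card_rtrans [in leqRHS]card_fset_sum1 big_distrl /=.
  rewrite big_seq [leqRHS]big_seq; apply: leq_sum => t Tt; rewrite mul1n.
  apply: leq_trans (card_lpreim _ _ Tt) _.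
  by rewrite leq_add2l; exact: fsubset_leq_card.
have cardE : (#|` E| <= #|` T j| * #|` K j|)%N.
  apply: (@leq_trans (\sum_(x <- F) #|` tile (j, x) `&` K j|)).
    rewrite card_fset_sum; apply: leq_sum => x _.
    by rewrite -fsetI_eq0 -cardfs_gt0; case: #|` _|.
  rewrite /tile /= sum_card_rtrans [in leqRHS]card_fset_sum1 big_distrl /=.
  apply: leq_sum => t _; rewrite mul1n.
  set Y := [fset x in F | _].
  have <- : #|` [fset (t * x)%g | x in Y]| = #|` Y|.
    by rewrite card_imfset //; exact: mulgI.
  apply/fsubset_leq_card/fsubsetP => z /imfsetP[x /=].
  by rewrite !inE /= => /andP[_ tK] ->.
(* Each earlier tile lies in [W], so its points in [B] are on its [T j]-boundary. That boundary is
   small because the tile has index above [j]. *)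
have cardB : #r B <= 2 * del j * #r F + #r Q.
  have {1}-> : B = B `&` W.
    by apply/fsetP => x; rewrite !inE /=; case: (x \in W); rewrite ?(andbF, andbT).
  apply: card_le_parts => //.
  - by apply/fsubsetP => x; rewrite !inE /= => /andP[].
  - by rewrite mulr_ge0 // ltW // del_gt0.
  move=> L1 t L2 LE ft.
  have jt : (j < t.1)%N by move: jL; rewrite LE all_cat /= => /and3P[].
  apply: (@le_trans _ _ (#r (bdry (T j) (tile t)))).
    rewrite ler_nat; apply/fsubset_leq_card/fsubsetP => x.
    rewrite !inE /= => /andP[/andP[_ /andP[_ xW]] /andP[_ xt]]; rewrite xt /=.
    have tW : tile t `<=` W.
      by rewrite /W LE; apply: fsubset_trans (cover_cat _ _ _ _); rewrite /= fsubsetUr.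
    apply: contraNT xW => /hasPn xt'; apply/fsubsetP => z.
    rewrite in_rtrans /= => /xt'; rewrite negbK mulgVK.
    exact: (fsubsetP tW).
  rewrite /tile bdry_rtrans card_rtrans.
  apply: le_trans (bdry_shape jt) _.
  rewrite [2 * _]mulrC -(mulrA (del j)) ler_pM2l ?del_gt0 //; exact: card_shape_part.
have cardI : #r (F `&` W) <= #r I + #r B.
  rewrite -natrD ler_nat.
  apply: (@leq_trans #|` I `|` B|); last by rewrite cardfsU leq_subr.
  apply/fsubset_leq_card/fsubsetP => x; rewrite !inE /= => /andP[-> ->] /=.
  by rewrite orbN.
(* Pointwise: a point of [I] has weight [(j + 1) + 1], any other point weight 1, and the last term
   pays for the points of [E]. *)
have main : (#|` T j| * (j.+1 * #|` I| + #|` F|) <=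
    j.+2 * (\sum_(x <- F) #|` tile (j, x) `&` W'|) + #|` T j| * #|` E|)%N.
  rewrite /I /E !card_fset_sum (card_fset_sum1 F) !big_distrr /=.
  rewrite -!(@big_split _ _ addn) big_distrr /= big_seq [leqRHS]big_seq.
  apply: leq_sum => x Fx.
  have [xW|xW] := boolP (tile (j, x) `<=` W).
    rewrite (fsetIidPl (fsubset_trans xW WW')) /tile card_rtrans /=.
    by rewrite muln1 addn1 mulnC leq_addr.
  rewrite muln0 add0n muln1.
  have [dis|_] := boolP [disjoint tile (j, x) & K j]%fset; last by rewrite muln1 leq_addl.
  rewrite muln0 addn0 mulnC; apply: stage_cover dis; exact: Fcs.
have {}main : (j.+1 * #|` I| + #|` F| <= j.+2 * (#|` F `&` W'| + #|` Q|) + #|` E|)%N.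
  rewrite -(@leq_pmul2l _ _ _ n_gt0). apply: leq_trans main _.
  by rewrite mulnDr leq_add2r mulnCA leq_mul2l /= sumW'.
have := cardfsID W F; have := cardfsID W' F.
move=> /(congr1 (fun n => n%:R : R)); rewrite natrD => e'.
move=> /(congr1 (fun n => n%:R : R)); rewrite natrD => e.
move: main; rewrite -(ler_nat R) !(natrD _ (_ * _)%N) !natrM (natrD _ #|` F `&` W'|) => main.
move: cardE; rewrite -(ler_nat R) natrM => cardE.
rewrite epsE.
have j2 : j.+2%:R * eps j = 1 by rewrite mulfV // pnatr_eq0.
have j12 : j.+2%:R = j.+1%:R + 1 :> R by rewrite natr1.
(* With [p = j + 1] and [d = del j * #r F], multiplying by [p + 1] leaves errors [3 p d] from [B],
   [(p + 1) d] from [Q] and [d] from [E], in total at most [5 (p + 1) d]. *)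
rewrite -(ler_pM2l (ltr0Sn R j.+1)) mulrDr -(mulrA j.+1%:R) mulrCA.
rewrite (mulrA j.+2%:R (eps j)) j2 mul1r.
have p0 : 0 <= j.+1%:R :> R by exact: ler0n.
have d0 : 0 <= del j * #r F by rewrite mulr_ge0 ?ler0n // ltW // del_gt0.
move: main cardB; rewrite j12 -(mulrA 2); move: d0 Qle Kle cardE cardI e e' p0.
move: (del j * #r F) => d.
move: (#r (F `\` W')) (#r (F `\` W)) (#r (F `&` W')) (#r (F `&` W)) (#r I) (#r B).
move: (#r E) (#r Q) (#r F) (#r (T j) * #r (K j)) (j.+1%:R : R).
move=> ee q f tk p u' u w' w i b d0 Qle Kle cardE cardI e e' p0 main cardB.
have := ler_wpM2l p0 cardI; have := ler_wpM2l p0 cardB; have := ler_wpM2l p0 Qle.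
have := mulr_ge0 p0 d0.
have ew' : w' = f - u' by lra.
have ew : w = f - u by lra.
subst w w'; lra.
Qed.

Section AllStages.
Variables (J M : nat).
Hypothesis JM : (J <= M)%N.
Hypothesis bdryQ : forall j, (j <= J)%N -> bdry (T j) F `<=` Q.
Hypothesis cardQ : #r Q <= del J * #r F.
Hypothesis cardK : forall j, (j <= J)%N -> #r (T j) * #r (K j) <= del j * #r F.

(** Downward induction from [a = J + 1], where the bound is trivial whatever the stages above [J]
    did. The factors [1 - eps j] multiply to [(a + 1) / (J + 2)], and the errors [5 * del j] sum to
    at most [5 / (a + 1)]. *)
Lemma tiling_uncovered a : (a <= J.+1)%N ->
  #r (F `\` cover (tiling cs a (M.+1 - a))) <=
    (a.+1%:R / J.+2%:R + 5 / a.+1%:R) * #r F.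
Proof.
have F0 : 0 <= #r F by exact: ler0n.
move Ed : (J.+1 - a)%N => d; elim: d a Ed => [|d IH] a Ed aJ.
  have -> : a = J.+1 by lia.
  apply: (@le_trans _ _ (#r F)); first by rewrite ler_nat fsubset_leq_card // fsubsetDl.
  by rewrite mulfV ?pnatr_eq0 // ler_peMl // lerDl divr_ge0.
have aJ' : (a <= J)%N by lia.
have -> : (M.+1 - a = (M.+1 - a.+1).+1)%N by lia.
rewrite tilingS.
have Qa : #r Q <= del a * #r F.
  by apply: le_trans cardQ _; rewrite ler_wpM2r // del_le.
apply: le_trans (stage_uncovered (bdryQ aJ') Qa (cardK aJ') (valid_tiling _ _ _ _ _ _) (tiling_ge _ _ _ _ _ _)) _.
have {}IH : #r (F `\` cover (tiling cs a.+1 (M.+1 - a.+1))) <=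
    (a.+2%:R / J.+2%:R + 5 / a.+2%:R) * #r F by apply: IH; lia.
have e0 := epsE a; have e1 : 0 <= 1 - eps a by rewrite e0 mulr_ge0 // ltW // eps_gt0.
have {IH} := ler_wpM2l e1 IH.
have e2 : (1 - eps a) * (a.+2%:R / J.+2%:R) = a.+1%:R / J.+2%:R.
  by rewrite e0 mulrA -(mulrA a.+1%:R) /eps mulVf ?pnatr_eq0 // mulr1.
have e3 : (1 - eps a) * (5 / a.+2%:R) <= 5 / a.+2%:R.
  by rewrite ler_piMl ?divr_ge0 // gerBl ltW // eps_gt0.
rewrite (mulrA (1 - eps a)) (mulrDr (1 - eps a)) e2 => IH.
have := ler_wpM2r F0 e3; rewrite delE; move: IH.
move: (_ / J.+2%:R) (a.+1%:R^-1) (a.+2%:R^-1) (1 - eps a).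
by move=> x y z w IH; lra.
Qed.

(** Points missed by the tiles of index at least [a] are charged to the uncovered set, so only those
    tiles need a bound. *)
Lemma card_le_tiling a B (k : R) : B `<=` F -> 0 <= k -> (a <= M.+1)%N ->
    (forall L1 t L2, tiling cs 0 M.+1 = L1 ++ t :: L2 -> (a <= t.1)%N ->
       fits S1 S2 K t L2 -> #r (B `&` part t L2) <= k * #r (part t L2)) ->
  #r B <= k * #r F + #r Q + #r (F `\` cover (tiling cs a (M.+1 - a))).
Proof.
move=> BF k0 aM Hk.
have [L0] := tiling_cat S1 S2 K cs 0 a (M.+1 - a); rewrite add0n subnKC // => eL.
set L := tiling cs a _ in eL *.
rewrite -(cardfsID (cover L) B) natrD; apply: lerD; last first.
  by rewrite ler_nat fsubset_leq_card // fsetSD.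
apply: card_le_parts => //; first exact: valid_tiling.
move=> L1 t L2 LE; apply: (Hk (L0 ++ L1)); first by rewrite eL LE catA.
have := tiling_ge S1 S2 K cs a (M.+1 - a).
by rewrite -/L LE all_cat /= => /and3P[].
Qed.

Section Fine.
Variable a : nat.
Hypothesis aJ : (a.+1 ^ 2 <= J.+2)%N.

(** Here 7 is 5 + 1 + 1: besides the 5 of [tiling_uncovered], both [(a + 1) / (J + 2)] and [del J]
    are at most [1 / (a + 1)]. *)
Lemma fine_uncovered :
  #r Q + #r (F `\` cover (tiling cs a (M.+1 - a))) <= 7 / a.+1%:R * #r F.
Proof.
have F0 : 0 <= #r F by exact: ler0n.
have aJ' : (a <= J)%N by nia.
have h1 : a.+1%:R / J.+2%:R <= a.+1%:R^-1 :> R.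
  rewrite ler_pdivrMr // ler_pdivlMl // -natrM ler_nat; move: aJ; lia.
have h2 : del J <= a.+1%:R^-1.
  apply: le_trans (del_le aJ') _.
  by rewrite /del ler_piMr ?invr_ge0 // invf_le1 ?ler1n.
move: cardQ (ler_wpM2r F0 h1) (ler_wpM2r F0 h2) (tiling_uncovered (leqW aJ')).
by move: (_ / J.+2%:R) (a.+1%:R^-1) => x y; lra.
Qed.

(** Upper bounds for two complementary sets also give the lower bounds. In each part [B] stays
    inside one half of the tile; the 8 is 7 plus 1 for [eps a]. *)
Lemma tiling_half B :
    B = F `&` half (tiling cs 0 M.+1) \/ B = F `\` half (tiling cs 0 M.+1) ->
  #r B <= (2^-1 + 8 / a.+1%:R) * #r F.
Proof.
move=> HB.
have F0 : 0 <= #r F by exact: ler0n.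
have aM : (a <= M.+1)%N by nia.
have BF : B `<=` F by case: HB => ->; rewrite ?fsubsetIl ?fsubsetDl.
have k0 : 0 <= 2^-1 + eps a by rewrite addr_ge0 ?invr_ge0 // ltW // eps_gt0.
have ea : eps a <= a.+1%:R^-1 by rewrite lef_pV2 ?posrE ?ler_nat.
suff : #r B <= (2^-1 + eps a) * #r F + #r Q + #r (F `\` cover (tiling cs a (M.+1 - a))).
  move: fine_uncovered (ler_wpM2r F0 ea); move: (a.+1%:R^-1) (eps a) => x y.
  lra.
apply: card_le_tiling => // L1 t L2 LE at1 ft.
apply: (@le_trans _ _ (2^-1 * #r (T t.1))).
  have -> : 2^-1 * #r (T t.1) = #r (S1 t.1).
    by rewrite card_shape -cardS natrD; lra.
  rewrite ler_nat; case: HB => ->; [|rewrite cardS]; rewrite -(card_rtrans (_ t.1) t.2).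
    apply/fsubset_leq_card/fsubsetP => x; rewrite !in_fsetI => /andP[/andP[_ +] xt].
    by rewrite LE part_half.
  apply/fsubset_leq_card/fsubsetP => x; rewrite in_fsetI in_fsetD => /andP[/andP[+ _] xt].
  rewrite LE part_half //; move: xt; rewrite /part in_fsetD => /andP[_].
  by rewrite /tile rtransU in_fsetU => /orP[->|].
(* Half of the shape is at most half of the part plus [eps / 2] of the shape, and the latter is at
   most [eps] times the part. *)
have := card_part ft; have := card_shape_part ft; have := eps_le at1.
have := ler0n R #|` T t.1|; have := eps_gt0 t.1.
move: (eps a) (eps t.1) (#r (T t.1)) (#r (part t L2)) => x y z w y0 z0 yx zw zw'.
nra.
Qed.

(** If [g] changes the colour of a point of a part, it moves the point out of its half ([Z]) or onto
    an earlier tile ([V]). The 11 is 7 plus the 4 from [2 * (del a + eps a)]. *)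
Lemma tiling_inv g : (forall j, (a <= j)%N -> g \in X j) ->
  #r [fset x in F | (x \in half (tiling cs 0 M.+1)) != ((g * x)%g \in half (tiling cs 0 M.+1))]
    <= 11 / a.+1%:R * #r F.
Proof.
move=> gX.
set L := tiling cs 0 M.+1; set B := [fset x in F | _].
have F0 : 0 <= #r F by exact: ler0n.
have aM : (a <= M.+1)%N by nia.
have BF : B `<=` F by apply/fsubsetP => x; rewrite !inE => /andP[].
have ea : eps a <= a.+1%:R^-1 by rewrite lef_pV2 ?posrE ?ler_nat.
have da : del a <= a.+1%:R^-1.
  by rewrite /del ler_piMr ?invr_ge0 // invf_le1 ?ler1n.
have k0 : 0 <= 2 * (del a + eps a).
  by rewrite mulr_ge0 // addr_ge0 // ltW // ?eps_gt0 ?del_gt0.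
suff : #r B <= (2 * (del a + eps a)) * #r F + #r Q + #r (F `\` cover (tiling cs a (M.+1 - a))).
  move: fine_uncovered (ler_wpM2r F0 ea) (ler_wpM2r F0 da).
  move: (a.+1%:R^-1) (eps a) (del a) => x y z.
  lra.
apply: card_le_tiling => // L1 t L2 LE at1 ft.
pose Z := bdry (X t.1) (rtrans (S1 t.1) t.2) `|` bdry (X t.1) (rtrans (S2 t.1) t.2).
pose V := [fset (g^-1 * x)%g | x in tile t `&` cover L2].
have BZV : B `&` part t L2 `<=` Z `|` V.
  apply/fsubsetP => x; rewrite in_fsetI => /andP[xB xt].
  have [xV|xV] := boolP (x \in V); first by rewrite in_fsetU xV orbT.
  have gp : (g * x)%g \in tile t -> (g * x)%g \in part t L2.
    move=> gt; rewrite /part in_fsetD gt andbT; apply: contra xV => gL.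
    by apply/imfsetP; exists (g * x)%g; rewrite ?mulKg //= in_fsetI gt.
  have gX1 : g \in X t.1 by exact: gX.
  move: xB; rewrite !inE /= => /andP[_]; rewrite /L LE part_half // => xgx.
  have [x1|x1] := boolP (x \in rtrans (S1 t.1) t.2).
    apply/orP; left; apply/orP; left; rewrite /=.
    apply/hasP; exists g => //; apply/negP => gx1.
    have gt : (g * x)%g \in tile t by rewrite /tile rtransU in_fsetU gx1.
    by move: xgx; rewrite (part_half _ (gp gt)) x1 gx1.
  have x2 : x \in rtrans (S2 t.1) t.2.
    move: xt; rewrite /part in_fsetD => /andP[_].
    by rewrite /tile rtransU in_fsetU (negPf x1).
  apply/orP; left; apply/orP; right; rewrite x2 /=.
  apply/hasP; exists g => //; apply/negP => gx2.
  have gt : (g * x)%g \in tile t by rewrite /tile rtransU in_fsetU gx2 orbT.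
  move: xgx; rewrite (part_half _ (gp gt)) (negPf x1) /= => /negPn.
  move: gx2; rewrite !in_rtrans => gx2 gx1.
  by move: (disjS t.1) => /fdisjointP/(_ _ gx1); rewrite gx2.
have cV : #r V <= eps t.1 * #r (T t.1).
  rewrite card_imfset /=; last exact: mulgI.
  case/andP: ft => _; rewrite -(ler_nat R) natrM => ft.
  by rewrite mulrC ler_pdivlMr.
have cZ : #r Z <= del t.1 * #r (T t.1).
  rewrite card_shape natrD mulrDr.
  apply: le_trans (lerD (invS1 t.1) (invS2 t.1)); rewrite -natrD ler_nat.
  rewrite -(card_rtrans (bdry _ (S1 _)) t.2) -(card_rtrans (bdry _ (S2 _)) t.2).
  by rewrite -!bdry_rtrans cardfsU leq_subr.
have : #r (B `&` part t L2) <= #r Z + #r V.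
  rewrite -natrD ler_nat; apply: leq_trans (fsubset_leq_card BZV) _.
  by rewrite cardfsU leq_subr.
move=> /le_trans; apply; apply: le_trans (lerD cZ cV) _; rewrite -mulrDl.
have ed : del t.1 + eps t.1 <= del a + eps a by rewrite lerD ?del_le ?eps_le.
apply: le_trans (ler_wpM2r (ler0n _ _) ed) _.
rewrite -mulrA mulrCA ler_wpM2l ?(card_shape_part ft) //.
by rewrite addr_ge0 // ltW // ?eps_gt0 ?del_gt0.
Qed.

End Fine.
End AllStages.
End OneSet.
End Estimates.

(** * Consequences of the Følner condition and choice of the shapes *)

Lemma eventually_seq (T : eqType) (s : seq T) (P : T -> nat -> Prop) :
    (forall x, exists n0, forall n, (n0 <= n)%N -> P x n) ->
  exists n0, forall n, (n0 <= n)%N -> forall x, x \in s -> P x n.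
Proof.
move=> /choice[f fP]; exists (\max_(x <- s) f x)%N => n sn x xs.
by apply: fP; apply: leq_trans sn; exact: leq_bigmax_seq.
Qed.

Section Folner.
Variables (R : realType) (G : groupType) (F : nat -> {fset G}).
Hypothesis F_folner : folner R F.
Hypothesis Gcountable : countable [set: G].
Hypothesis Ginfinite : infinite_set [set: G].
Local Notation "#r A" := (#|` A|%:R : R) (at level 10, A at level 8).

Lemma folner_gt0 N : 0 < #r (F N).
Proof. by rewrite ltr0n cardfs_gt0; case: F_folner => /(_ N). Qed.

(** Each [h] in [D] maps the points it expels injectively into a symmetric difference. The successor
    in [e] covers the case of empty [D]. *)
Lemma folner_bdry (D : {fset G}) (d : R) : 0 < d ->
  exists n0, forall n, (n0 <= n)%N -> #r (bdry D (F n)) <= d * #r (F n).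
Proof.
move=> d0; pose e := d / (#|` D|.+1)%:R.
have e0 : 0 < e by rewrite divr_gt0.
have [] := @eventually_seq _ D
  (fun h n => #r (symdiff (lcoset_fset h (F n)) (F n)) <= e * #r (F n)).
  move=> h; have /cvgrPdist_le/(_ _ e0)[n0 _ n0P] := F_folner.2 h.
  exists n0 => n /n0P /=; rewrite sub0r normrN ger0_norm ?divr_ge0 //.
  by rewrite ler_pdivrMr // folner_gt0.
move=> n0 n0P; exists n0 => n /n0P {}n0P.
apply: (@le_trans _ _ (\sum_(h <- D) #r (symdiff (lcoset_fset h (F n)) (F n)))).
  rewrite -natr_sum ler_nat.
  apply: (@leq_trans (\sum_(h <- D) #|` [fset x in F n | (h * x)%g \notin F n]%fset|)).
    rewrite (eq_bigr _ (fun h _ => card_fset_sum (F n) (fun x => (h * x)%g \notin F n))).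
    rewrite exchange_big /= card_fset_sum; apply: leq_sum => x _.
    case: hasP => // -[h Dh hx].
    by rewrite (big_rem h) //= hx.
  apply: leq_sum => h _; set Y := [fset x in F n | _]%fset.
  have <- : #|` [fset (h * x)%g | x in Y]%fset| = #|` Y|.
    by rewrite card_imfset //; exact: mulgI.
  apply/fsubset_leq_card/fsubsetP => z /imfsetP[x /=].
  rewrite !inE /= => /andP[Fx hx] ->; rewrite hx /=.
  by apply/orP; left; apply/imfsetP; exists x.
apply: (@le_trans _ _ (\sum_(h <- D) e * #r (F n))).
  by rewrite big_seq [leRHS]big_seq; exact: ler_sum.
rewrite big_const_seq count_predT iter_addr_0 -[leLHS]mulr_natl mulrA.
rewrite ler_wpM2r // /e mulrCA ger_pMr //.
by rewrite ler_pdivrMr // mul1r ler_nat.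
Qed.

(** Some [x] in [F N] is off the boundary for a set [A] of at least [n] elements, and then [F N]
    contains [A x]. *)
Lemma folner_card n : exists n0, forall N, (n0 <= N)%N -> (n <= #|` F N|)%N.
Proof.
have [A _ cA] := infinite_set_fset n Ginfinite.
have h0 : 0 < 2^-1 :> R by rewrite invr_gt0.
have [n0 n0P] := folner_bdry A h0; exists n0 => N /n0P bF.
have [x Fx xb] : exists2 x, x \in F N & x \notin bdry A (F N).
  apply: contrapT => nx; have FN := folner_gt0 N.
  have : (F N `<=` bdry A (F N))%fset.
    apply/fsubsetP => x Fx; apply: contrapT => /negP xb; apply: nx; by exists x.
  by move=> /fsubset_leq_card; rewrite -(ler_nat R); lra.
apply: leq_trans cA _; rewrite -(card_rtrans A x).
apply/fsubset_leq_card/fsubsetP => z /imfsetP[t /= At ->].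
apply: contraNT xb => tF; apply/bdryP; split => //; by exists t.
Qed.

Lemma exists_fresh (A : {fset G}) : exists y, y \notin A.
Proof.
apply: contrapT => nA; apply: Ginfinite.
apply: (@sub_finite_set _ _ [set` A]); last exact: finite_fset.
by move=> y _; apply: contrapT => /negP yA; apply: nA; exists y.
Qed.

Lemma exists_shape (X : {fset G}) (d : R) : 0 < d ->
  exists S : {fset G} * {fset G},
    [/\ #|` S.1| = #|` S.2|, [disjoint S.1 & S.2]%fset, S.1 != fset0,
        #r (bdry X S.1) <= d * #r S.1 & #r (bdry X S.2) <= d * #r S.2].
Proof.
move=> d0; have [n nP] := folner_bdry X d0; have {}nP := nP n (leqnn n).
(* A common point [x] of [F n] and its translate would give [y = (x * y^-1)^-1 * x]. *)
have [y yS] := exists_fresh [fset (a^-1 * b)%g | a in F n, b in F n]%fset.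
exists (F n, rtrans (F n) y); split => /=.
- by rewrite card_rtrans.
- apply/fdisjointP => x Fx; rewrite in_rtrans; apply: contra yS => Fy.
  by apply/imfset2P; exists (x * y^-1)%g => //; exists x => //; rewrite invgM invgK mulgVK.
- by case: F_folner => /(_ n).
- by [].
- by rewrite bdry_rtrans !card_rtrans.
Qed.

Lemma exists_enum : exists g : nat -> G, forall x, exists n, g n = x.
Proof.
have /countable_injP[f f_inj] := Gcountable.
exists (fun n => xget 1%g [set x | f x = n]) => x; exists (f x).
case: xgetP => [y _ fy|/(_ x)/(_ erefl) //].
by apply: f_inj; rewrite ?in_setE.
Qed.

Lemma exists_shapes : exists (S1 S2 X : nat -> {fset G}),
  [/\ forall j, [/\ #|` S1 j| = #|` S2 j|, [disjoint S1 j & S2 j]%fset, S1 j != fset0,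
        #r (bdry (X j) (S1 j)) <= del R j * #r (S1 j) &
        #r (bdry (X j) (S2 j)) <= del R j * #r (S2 j)],
      forall i j, (i < j)%N -> (shape S1 S2 i `<=` X j)%fset &
      forall x, exists a, forall j, (a <= j)%N -> x \in X j].
Proof.
have [g g_surj] := exists_enum.
have /choice[s sP] := fun p : {fset G} * nat => exists_shape p.1 (del_gt0 R p.2).
(* Shape [j] is chosen for [X j], and [X j.+1] absorbs it together with the next element of the
   enumeration. *)
pose X := fix X n := if n is m.+1 then
    (X m `|` ((s (X m, m)).1 `|` (s (X m, m)).2) `|` [fset g m])%fset else fset0.
have XS i j : (i <= j)%N -> (X i `<=` X j)%fset.
  elim: j => [|j IH]; first by rewrite leqn0 => /eqP ->.
  rewrite leq_eqVlt => /orP[/eqP -> //|/IH Xij].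
  by apply: fsubset_trans Xij _; rewrite /= -fsetUA fsubsetUl.
exists (fun j => (s (X j, j)).1), (fun j => (s (X j, j)).2), X; split.
- by move=> j; exact: sP (X j, j).
- move=> i j ij; apply: fsubset_trans (XS i.+1 j ij).
  by rewrite /shape /= -fsetUA fsubsetU // fsubsetUl orbT.
- move=> x; have [n <-] := g_surj x; exists n.+1 => j nj.
  by apply: (fsubsetP (XS _ _ nj)); rewrite /= !inE eqxx orbT.
Qed.

(** The thresholds do not depend on [M]; this uniformity is what the passage to the limit needs. *)
Lemma exists_halves : exists E : nat -> {fset G},
  (forall a, exists n0, forall N M, (n0 <= N <= M)%N -> forall B,
     B = (F N `&` E M)%fset \/ B = (F N `\` E M)%fset ->
     #r B <= (2^-1 + 8 / a.+1%:R) * #r (F N)) /\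
  (forall g, exists a0, forall a, (a0 <= a)%N ->
   exists n0, forall N M, (n0 <= N <= M)%N ->
     #r [fset x in F N | (x \in E M) != ((g * x)%g \in E M)]%fset
       <= 11 / a.+1%:R * #r (F N)).
Proof.
have [S1 [S2 [X [HS HT HX]]]] := exists_shapes.
pose T := shape S1 S2.
(* If a tile of index [j] contains [x] in [F N] and [z] outside, then [z * x^-1] moves [x] out of
   [F N]. Including [T j] puts the [T j]-boundary into [Q] as well. *)
pose quot j := (T j `|` [fset (x * y^-1)%g | x in T j, y in T j])%fset.
pose D j := (\bigcup_(i <- iota 0 j.+1) quot i)%fset.
(* The clause [j <= n] bounds the indices [j] with [n1 j <= N], so that a largest one exists. *)
have /choice[n1 n1P] : forall j, exists n, (j <= n)%N /\
    forall N, (n <= N)%N -> #r (bdry (D j) (F N)) <= del R j * #r (F N).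
  move=> j; have [n nP] := folner_bdry (D j) (del_gt0 R j).
  exists (maxn j n); split; first exact: leq_maxl.
  by move=> N; rewrite geq_max => /andP[_]; exact: nP.
(* A tile of index [j] avoids [K j], so it only meets those [F N] that are
   invariant under [D j]. *)
pose K j := (\bigcup_(N <- iota 0 (n1 j)) F N)%fset.
have /choice[n2 n2P] : forall j, exists n, (n1 j <= n)%N /\
    forall N, (n <= N)%N -> #r (T j) * #r (K j) <= del R j * #r (F N).
  move=> j; have [n nP] := folner_card (Num.truncn (#r (T j) * #r (K j) / del R j)).+1.
  exists (maxn (n1 j) n); split; first exact: leq_maxl.
  move=> N; rewrite geq_max => /andP[_ /nP]; rewrite -(ler_nat R) => h.
  rewrite [leRHS]mulrC -ler_pdivrMr ?del_gt0 //; apply: le_trans h.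
  by apply/ltW; rewrite truncnS_gt.
pose cs M := enum_fset (\bigcup_(N <- iota 0 M.+1) F N)%fset.
pose E M := half S1 S2 (tiling S1 S2 K (cs M) 0 M.+1).
(* The estimates are applied with [J = (a + 1)^2], which meets the requirement
   [(a + 1)^2 <= J + 2]. *)
pose n0 a := (\max_(j < (a.+1 ^ 2).+1) n2 j)%N.
have key a N M : (n0 a <= N <= M)%N -> exists Q : {fset G},
  [/\ forall t, [disjoint tile S1 S2 t & K t.1]%fset ->
         (F N `&` tile S1 S2 t `<=` Q)%fset \/ (tile S1 S2 t `<=` F N)%fset,
      (a.+1 ^ 2 <= M)%N,
      forall j, (j <= a.+1 ^ 2)%N -> (bdry (T j) (F N) `<=` Q)%fset,
      #r Q <= del R (a.+1 ^ 2) * #r (F N) &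
      forall j, (j <= a.+1 ^ 2)%N -> #r (T j) * #r (K j) <= del R j * #r (F N)].
  move=> /andP[aN NM].
  have n2N j : (j <= a.+1 ^ 2)%N -> (n2 j <= N)%N.
    rewrite -ltnS => ja; apply: leq_trans aN.
    exact: (leq_bigmax (Ordinal ja)).
  have n1N j : (j <= a.+1 ^ 2)%N -> (n1 j <= N)%N.
    by move=> /n2N; apply: leq_trans; case: (n2P j).
  have exJ : exists J, (n1 J <= N)%N by exists (a.+1 ^ 2)%N; exact: n1N.
  have ubJ i : (n1 i <= N)%N -> (i <= N)%N.
    by apply: leq_trans; case: (n1P i).
  (* Tiles of index above this [J] avoid [F N] by the choice of [K]; all others can cross only
     inside the [D J]-boundary. *)
  case: (ex_maxnP exJ ubJ) => J n1J maxJ.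
  have aJ : (a.+1 ^ 2 <= J)%N by exact/maxJ/n1N.
  have quotD i : (i <= J)%N -> (quot i `<=` D J)%fset.
    by move=> iJ; apply: bigfcup_sup => //; rewrite mem_iota.
  exists (bdry (D J) (F N)); split.
  - move=> t /fdisjointP dis; have [tN|tN] := ltnP N (n1 t.1).
      left; apply/fsubsetP => x; rewrite in_fsetI => /andP[Fx /dis /negP].
      case; apply/bigfcupP; exists N; rewrite // mem_iota add0n tN //.
    have tJ : (t.1 <= J)%N by exact: maxJ.
    have [|ntF] := boolP (tile S1 S2 t `<=` F N)%fset; [by right|left].
    have /fsubsetPn[z zt zF] := ntF.
    apply/fsubsetP => x; rewrite in_fsetI => /andP[Fx xt]; apply/bdryP; split => //.
    exists (z * x^-1)%g; last by rewrite mulgVK.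
    apply: (fsubsetP (quotD _ tJ)); rewrite /quot in_fsetU; apply/orP; right.
    apply/imfset2P; exists (z * t.2^-1)%g; first by rewrite -in_rtrans.
    exists (x * t.2^-1)%g; first by rewrite -in_rtrans.
    by rewrite invgM invgK mulgA mulgVK.
  - apply: leq_trans NM; apply: leq_trans (n1N _ (leqnn _)).
    by case: (n1P (a.+1 ^ 2)%N).
  - move=> j ja; apply: bdryS; apply: fsubset_trans (quotD j _); last exact: leq_trans aJ.
    by rewrite fsubsetUl.
  - apply: le_trans (proj2 (n1P J) _ n1J) _.
    by rewrite ler_wpM2r // del_le.
  - by move=> j /n2N; exact: (proj2 (n2P j)).
have cardS j : #|` S1 j| = #|` S2 j| by case: (HS j).
have disjS j : [disjoint S1 j & S2 j]%fset by case: (HS j).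
have neqS j : S1 j != fset0 by case: (HS j).
have invS1 j : #r (bdry (X j) (S1 j)) <= del R j * #r (S1 j) by case: (HS j).
have invS2 j : #r (bdry (X j) (S2 j)) <= del R j * #r (S2 j) by case: (HS j).
have Fcs N M : (N <= M)%N -> {subset F N <= cs M}.
  by move=> NM x Fx; apply/bigfcupP; exists N; rewrite // mem_iota add0n ltnS NM.
exists E; split.
  move=> a; exists (n0 a) => N M nNM B HB.
  have [Q [h1 h2 h3 h4 h5]] := key a N M nNM.
  have /andP[_ NM] := nNM.
  apply: (tiling_half cardS disjS neqS invS1 invS2 HT (Fcs N M NM) h1 h2 h3 h4 h5 _ HB).
  exact: leqW (leqnSn _).
move=> g; have [a0 a0P] := HX g; exists a0 => a a0a; exists (n0 a) => N M nNM.
have [Q [h1 h2 h3 h4 h5]] := key a N M nNM.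
have /andP[_ NM] := nNM.
apply: (tiling_inv disjS neqS invS1 invS2 HT (Fcs N M NM) h1 h2 h3 h4 h5 (leqW (leqnSn _))).
by move=> j aj; apply: a0P; exact: leq_trans aj.
Qed.

End Folner.

(* [E'] is the limit of [E] along an ultrafilter on [nat] refining [\oo]. *)
Lemma exists_finite_limit (T : choiceType) (E : nat -> {fset T}) :
  exists E' : set T, forall (Z : {fset T}) n,
    exists2 M, (n <= M)%N & {in Z, forall x, (x \in E') = (x \in E M)}.
Proof.
have [U [Uultra oU]] := @ultraFilterLemma nat \oo _.
pose E' : set T := [set x | U [set M | x \in E M]].
exists E' => Z n.
have UZ x : U [set M | (x \in E') = (x \in E M)].
  have [Ux|Ux] := in_ultra_setVsetC [set M | x \in E M] Uultra.
    by apply: filterS (Ux) => M /= ->; apply/idP; rewrite in_setE.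
  apply: filterS (Ux) => M /= /negP/negPf ->; apply/negbTE/negP; rewrite in_setE => Ux'.
  by have [M' []] := filter_ex (filterI Ux Ux').
(* Finitely many [U]-large sets and a tail of [nat] have a common element. *)
have : U ([set M | (n <= M)%N] `&` [set M | {in enum_fset Z, forall x, (x \in E') = (x \in E M)}]).
  apply: filterI; first by apply: oU; exists n.
  elim: (enum_fset Z) => [|z s IH]; first by apply: filterS filterT.
  apply: filterS (filterI (UZ z) IH) => M [/= zM sM] x; rewrite inE => /orP[/eqP -> //|].
  exact: sM.
by move=> /filter_ex[M [nM ZM]]; exists M.
Qed.

(** * Densities of the limit set and of finite unions of its translates *)

Unset Implicit Arguments.
Set Strict Implicit.
Set Printing Implicit Defensive.

Theorem proposition2p11 (R : realType) (G : groupType)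
    (Gcountable : countable [set: G]) (Ginfinite : infinite_set [set: G])
    (F : nat -> {fset G}) (F_folner : folner R F) :
  exists E : set G, forall A : {fset G}, A != fset0 ->
    has_density F E (1 / 2 : R) /\
    has_density F (\bigcup_(g in [set` A]) lcoset_set g E) (1 / 2 : R).
Proof.
have [E_ [halfE invE]] := exists_halves F_folner Gcountable Ginfinite.
have [E EE] := exists_finite_limit E_.
have F0 N : 0 < #|` F N|%:R :> R := folner_gt0 F_folner N.
have small (c e : R) : 0 <= c -> 0 < e -> exists a0, forall a, (a0 <= a)%N -> c / a.+1%:R <= e.
  move=> c0 e0; exists (Num.truncn (c / e)) => a ca.
  rewrite ler_pdivrMr // mulrC -ler_pdivrMr //; apply/ltW/(lt_le_trans (truncnS_gt _)).
  by rewrite ler_nat.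
have densE : has_density F E (1 / 2 : R).
  apply/cvgrPdist_le => e e0.
  have [a /(_ a (leqnn a)) ae] := small 8 e (ler0n _ _) e0.
  have [n0 n0P] := halfE a; exists n0 => // N /= nN.
  have [M NM EM] := EE (F N) N.
  have -> : [fset x in F N | x \in E]%fset = (F N `&` E_ M)%fset.
    by apply/fsetP => x; rewrite !inE /=; case: (boolP (x \in F N)) => //= /EM.
  have nNM : (n0 <= N <= M)%N by rewrite nN.
  have h1 := n0P N M nNM _ (or_introl erefl).
  have h2 := n0P N M nNM _ (or_intror erefl).
  have := cardfsID (E_ M) (F N) => /(congr1 (fun n => n%:R : R)); rewrite natrD => h3.
  rewrite distrC ler_distl ler_pdivlMr // ler_pdivrMr //.
  have := ler_wpM2r (ltW (F0 N)) ae; move: h1 h2 h3; move: (8 / _) => x.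
  by move=> h1 h2 h3 h4; apply/andP; split; lra.
have invE' g e : 0 < e -> exists n0, forall N, (n0 <= N)%N ->
    #|` [fset x in F N | (x \in E) != ((g * x)%g \in E)]%fset|%:R <= e * #|` F N|%:R :> R.
  move=> e0; have [a0 a0P] := invE g; have [a1 a1P] := small 11 e (ler0n _ _) e0.
  have [n0 n0P] := a0P _ (leq_maxl a0 a1); exists n0 => N nN.
  (* The condition at [x] also involves [g * x], so agreement is required on the translate too. *)
  have [M NM EM] := EE (F N `|` [fset (g * x)%g | x in F N])%fset N.
  have -> : [fset x in F N | (x \in E) != ((g * x)%g \in E)]%fset =
      [fset x in F N | (x \in E_ M) != ((g * x)%g \in E_ M)]%fset.
    apply/fsetP => x; rewrite !inE /=; case: (boolP (x \in F N)) => //= Fx.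
    by rewrite !EM // in_fsetU ?Fx //; apply/orP; right; apply/imfsetP; exists x.
  apply: le_trans (n0P N M _) _; first by rewrite nN.
  by rewrite ler_wpM2r // a1P // leq_maxr.
exists E => A A0; split => //.
set AE := \bigcup_(g in _) _.
have [g0 Ag0] := fset0Pn _ A0.
pose c N : R := #|` [fset x in F N | x \in E]%fset|%:R / #|` F N|%:R.
pose c' N : R := #|` [fset x in F N | x \in AE]%fset|%:R / #|` F N|%:R.
have dist0 : (fun N => c' N - c N) @ \oo --> (0 : R).
  apply/cvgrPdist_le => e e0.
  pose e' := e / (#|` A|%:R).
  have cA : 0 < #|` A|%:R :> R by rewrite ltr0n cardfs_gt0.
  have e'0 : 0 < e' by rewrite divr_gt0.
  have [n0 n0P] := @eventually_seq _ A _ (fun g => invE' (g^-1)%g _ e'0).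
  exists n0 => // N /= /n0P {}n0P.
  pose d g := [fset x in F N | (x \in E) != ((g^-1 * x)%g \in E)]%fset.
  (* Within [F N], [E] and [AE] differ only inside [Z]; that [E] lies in [AE] up to [Z] is seen with
     the single element [g0] of [A]. *)
  pose Z := (\bigcup_(g <- A) d g)%fset.
  have cZ : #|` Z|%:R <= e * #|` F N|%:R :> R.
    apply: (@le_trans _ _ (\sum_(g <- A) #|` d g|%:R)).
      rewrite -natr_sum ler_nat.
      apply: (big_ind2 (fun (B : {fset G}) n => #|` B| <= n)%N) => // B m C n Bm Cn.
      by apply: leq_trans (leq_add Bm Cn); rewrite cardfsU leq_subr.
    apply: (@le_trans _ _ (\sum_(g <- A) e' * #|` F N|%:R)).
      by rewrite big_seq [leRHS]big_seq; exact: ler_sum.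
    rewrite big_const_seq count_predT iter_addr_0 -[leLHS]mulr_natl mulrA.
    by rewrite /e' mulrCA divff ?mulr1 // gt_eqF.
  have inAE x : x \in AE <-> exists2 g, g \in A & (g^-1 * x)%g \in E.
    rewrite in_setE; split=> [[g Ag [y Ey <-]]|[g Ag gE]].
      by exists g => //; rewrite mulKg in_setE.
    by exists g => //; exists (g^-1 * x)%g; rewrite ?mulVKg // -in_setE.
  have inZ x g : x \in F N -> g \in A -> (x \in E) != ((g^-1 * x)%g \in E) -> x \in Z.
    by move=> Fx Ag dx; apply/bigfcupP; exists g; rewrite ?Ag // !inE /= Fx.
  have inF (B : set G) x :
      (x \in [fset x in F N | x \in B]%fset) = (x \in F N) && (x \in B).
    by apply/imfsetP/andP => [[y /andP[Fy By] ->]|[Fx Bx]] //; exists x => //; apply/andP.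
  have card_le (P P' : {fset G}) : (P' `<=` P `|` Z)%fset -> #|` P'|%:R <= #|` P|%:R + e * #|` F N|%:R :> R.
    move=> /fsubset_leq_card PZ; apply: le_trans (lerD (lexx _) cZ).
    by rewrite -natrD ler_nat; apply: leq_trans PZ _; rewrite cardfsU leq_subr.
  rewrite sub0r normrN -mulrBl normrM normfV (gtr0_norm (F0 N)) ler_pdivrMr //.
  rewrite ler_distlC; apply/andP; split.
    rewrite lerBlDr; apply: card_le; apply/fsubsetP => x.
    rewrite in_fsetU !inF => /andP[Fx /inAE[g Ag gE]]; rewrite Fx /=.
    have [//|xE] := boolP (x \in E).
    by apply: (inZ _ _ Fx Ag); rewrite gE (negPf xE).
  apply: card_le; apply/fsubsetP => x.
  rewrite in_fsetU !inF => /andP[Fx xE]; rewrite Fx /=.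
  have [gE|gE] := boolP ((g0^-1 * x)%g \in E).
    by apply/orP; left; apply/inAE; exists g0.
  by apply/orP; right; apply: (inZ _ _ Fx Ag0); rewrite xE (negPf gE).
have c'E : c' = c \+ (fun N => c' N - c N).
  by apply/funext => N; rewrite /= addrC subrK.
change (c' @ \oo --> (1 / 2 : R)).
by rewrite c'E -[1 / 2]addr0; exact: cvgD.
Qed.
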